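(* Let $C$ be a smooth projective curve of genus $2$ defined over $\mathbb{Q}$, and assume that $C$ has exactly four $\mathbb{Q}$-rational Weierstrass points. If $C$ is described by a globally minimal Weierstrass equation of the form $E:\ y^2+Q(x)y=P(x)$ with $P,Q\in\mathbb{Z}[x]$, $\deg Q(x)\le 2$ and $P(x)$ monic of degree $5$, then $|\Delta_E|$ is never an odd prime.
   Context: A Weierstrass equation of a genus two curve $C$ over $\mathbb{Q}$ is an equation $y^2+Q(x)y=P(x)$ with $P,Q\in\mathbb{Q}[x]$, $\deg Q\le 3$, $\deg P\le 6$, such that $x$ generates the subfield of $\mathbb{Q}(C)$ fixed by the hyperelliptic involution and $\mathbb{Q}(C)=\mathbb{Q}(x)[y]$. Its discriminant is $\Delta_E=2^{-12}\operatorname{disc}(4P(x)+Q(x)^2)$. A Weierstrass equation is integral if $P,Q\in\mathbb{Z}[x]$; it is minimal at a prime $p$ if it is integral and the $p$-adic valuation of its discriminant is smallest among all integral Weierstrass equations describing $C$ over $\mathbb{Z}_p$; it is globally minimal if it is minimal at every prime. Weierstrass points of $C$ are the fixed points of the hyperelliptic involution; $\mathbb{Q}$-rational ones are those defined over $\mathbb{Q}$. *)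

(* Defs.v *)
From mathcomp Require Import all_boot all_order all_algebra.
Set Implicit Arguments. Unset Strict Implicit. Unset Printing Implicit Defensive.
Import Order.TTheory GRing.Theory Num.Theory.
Local Open Scope ring_scope.

Definition disc_poly (f : {poly rat}) : rat :=
  let n := (size f).-1 in
  (-1) ^+ (n * n.-1 %/ 2) * resultant f f^`() / lead_coef f.

(* Discriminant of f viewed as a binary form of degree 6
   (the convention for genus-2 Weierstrass equations). *)
Definition disc6 (f : {poly rat}) : rat :=
  if size f == 7%N then disc_poly f
  else if size f == 6%N then lead_coef f ^+ 2 * disc_poly f
  else 0.

(* A Weierstrass equation y^2 + Q(x) y = P(x) over Q is given by the pair
   (P, Q) with deg Q <= 3, deg P <= 6. *)
Definition weq_shape (P Q : {poly rat}) : Prop :=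
  (size Q <= 4)%N /\ (size P <= 7)%N.

Definition wdisc (P Q : {poly rat}) : rat :=
  disc6 (4%:R *: P + Q ^+ 2) / 2%:R ^+ 12.

Definition genus2_eq (P Q : {poly rat}) : Prop :=
  weq_shape P Q /\ wdisc P Q != 0.

Definition homog (n : nat) (f : {poly rat}) (a b c d : rat) : {poly rat} :=
  \sum_(i < n.+1) f`_i *: ((a *: 'X + b%:P) ^+ i * (c *: 'X + d%:P) ^+ (n - i)).

(* Change of Weierstrass equation
     x = (a x' + b)/(c x' + d),  y = (e y' + H(x'))/(c x' + d)^3,
   giving the new equation y'^2 + Q'(x') y' = P'(x'). *)
Definition wtransQ (a b c d e : rat) (H : {poly rat}) (P Q : {poly rat}) :=
  e^-1 *: (2%:R *: H + homog 3 Q a b c d).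
Definition wtransP (a b c d e : rat) (H : {poly rat}) (P Q : {poly rat}) :=
  (e ^- 2) *: (homog 6 P a b c d - H * homog 3 Q a b c d - H ^+ 2).

Definition integral_eq (P Q : {poly rat}) : Prop :=
  forall i, denq P`_i = 1 /\ denq Q`_i = 1.
Definition p_integral (p : nat) (r : rat) : bool := ~~ (p %| absz (denq r))%N.
Definition p_integral_eq (p : nat) (P Q : {poly rat}) : Prop :=
  forall i, p_integral p P`_i /\ p_integral p Q`_i.

Definition vp (p : nat) (r : rat) : int :=
  (logn p (absz (numq r)))%:Z - (logn p (absz (denq r)))%:Z.

Definition minimal_at (p : nat) (P Q : {poly rat}) : Prop :=
  integral_eq P Q /\
  forall (a b c d e : rat) (H : {poly rat}),
    a * d - b * c != 0 -> e != 0 -> (size H <= 4)%N ->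
    p_integral_eq p (wtransP a b c d e H P Q) (wtransQ a b c d e H P Q) ->
    (vp p (wdisc P Q) <= vp p (wdisc (wtransP a b c d e H P Q)
                                     (wtransQ a b c d e H P Q)))%R.

Definition globally_minimal (P Q : {poly rat}) : Prop :=
  forall p, prime p -> minimal_at p P Q.

(* Affine Q-rational Weierstrass points: rational points (x,y) of the curve
   fixed by the hyperelliptic involution (x, y) |-> (x, -y - Q(x)). *)
Definition affine_wpt (P Q : {poly rat}) (pt : rat * rat) : bool :=
  (pt.2 ^+ 2 + Q.[pt.1] * pt.2 == P.[pt.1]) && (pt.2 == - pt.2 - Q.[pt.1]).

(* Weierstrass points at infinity: for deg(4P+Q^2) = 5 there is one (rational)
   point at infinity, fixed by the involution; for degree 6 there are two,
   swapped by the involution. *)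
Definition n_wpt_infty (P Q : {poly rat}) : nat :=
  if size (4%:R *: P + Q ^+ 2) == 6%N then 1%N else 0%N.

Definition num_rat_wpts_is (P Q : {poly rat}) (n : nat) : Prop :=
  exists s : seq (rat * rat),
    [/\ uniq s, (forall pt, pt \in s = affine_wpt P Q pt)
      & (size s + n_wpt_infty P Q)%N = n].

(* Main.v *)
(** Put F = 4P + Q^2. The three affine rational Weierstrass points give rational
    roots x1 < x2 < x3 of F, so F = 4 (x - x1)(x - x2)(x - x3)(x^2 + b x + c), and
    s_i = 4 x_i, B = 4 b, C = 16 c are integers. In these terms
    2^32 Delta = (B^2 - 4 C) M^2, where M is the product of the s_i - s_j and of
    the values g(s_i) of g = u^2 + B u + C. If |Delta| is an odd prime, M is a
    power of 2 up to sign, and so are all its factors.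
    Looking at F modulo powers of 2, each s_i is odd or divisible by 4, and at
    most one is odd. If exactly one is odd, it is at distance 1 from both others,
    which is impossible since these differ by a multiple of 4. If none is odd and
    Q has even coefficient at x^2, then b and c are integers and 2^8 divides
    Delta. Otherwise B^2 - 4 C is odd, so |M| = 2^16; with x = x2 - x1,
    y = x3 - x2 and the integers A_i = F'(x_i) / 4, this gives
    4 |A1 A2 A3| = x y (x + y), while 4 (A3 x - A1 y) is an odd multiple of
    x y (x + y)^2: the sizes are incompatible. *)
Require Import Defs.
From mathcomp Require Import all_boot all_order all_algebra.
From mathcomp Require Import all_field.
From mathcomp Require Import zify ring lra.
Import Order.TTheory GRing.Theory Num.Theory.
Local Open Scope ring_scope.

(** * Resultants and the discriminant in terms of roots *)

(* The matrix has the block shape [[0, f]; [1, *]], with f of size m x m. *)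
Lemma det_shift_block (R : comNzRingType) (m n : nat) (f : nat -> nat -> R) :
  \det (\matrix_(i < n + m, j < n + m)
          if (j < n)%N then (i == m + j :> nat)%N%:R else f i (j - n)%N)
  = (-1) ^+ (m * n) * \det (\matrix_(i < m, j < m) f i j).
Proof.
elim: n f => [|n IHn] f.
  rewrite muln0 mul1r; congr (\det _); apply/matrixP=> i j.
  by rewrite !mxE ltn0 subn0.
have lt_m : (m < (n + m).+1)%N by rewrite ltnS leq_addl.
rewrite (expand_det_col _ ord0) (bigD1 (Ordinal lt_m)) //= big1 => [|i ne_im].
  rewrite mxE /= addn0 eqxx mul1r addr0 /cofactor /= addn0 mulnS exprD -mulrA.
  (* Deleting row [m] replaces [f i] by [f (bump m i)], which is [f i] on the rows [i < m] of the
     final block. *)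
  congr (_ * _); rewrite [X in \det X](_ : _ = \matrix_(i < n + m, j < n + m)
    if (j < n)%N then (i == m + j :> nat)%N%:R else f (bump m i) (j - n)%N).
    rewrite (IHn (fun i j => f (bump m i) j)); congr (_ * \det _).
    by apply/matrixP=> i j; rewrite !mxE /bump leqNgt ltn_ord.
  apply/matrixP=> i j; rewrite !mxE /= /bump leq0n add1n ltnS subSS.
  case: ifP => // _; congr (nat_of_bool _)%:R; rewrite addnS.
  case: leqP => lt_im; first by rewrite add1n eqSS.
  have lt_imj : (i < m + j)%N by rewrite ltn_addr.
  by rewrite add0n !ltn_eqF // ltnW.
rewrite mxE /= addn0 (_ : (_ == _) = false) ?mul0r //.
by apply/eqP=> /= e; case/eqP: ne_im; apply/val_inj.
Qed.

(* The Sylvester matrix times [[0, V]; [1, *]], whose last columns hold the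
   powers of the roots, is block triangular since p vanishes at the roots. *)
Lemma resultant_roots (R : idomainType) (p q : {poly R}) (m : nat)
    (a : 'I_m -> R) :
  injective a -> size p = m.+1 -> (forall i, root p (a i)) ->
  resultant p q = (-1) ^+ (m * (size q).-1) * lead_coef p ^+ (size q).-1 *
                  \prod_i q.[a i].
Proof.
move=> inj_a sz_p pa0.
have def_m : m = (size p).-1 by rewrite sz_p.
subst m; set m := (size p).-1 in a inj_a sz_p pa0 *.
pose n := (size q).-1; rewrite -/n.
(* The default 0 only extends the entries to all column indices; those below [m] alone are read. *)
pose f i (j : nat) := if insub j is Some k then a k ^+ i else 0 : R.
have fE i (j : 'I_m) : f i j = a j ^+ i by rewrite /f valK.
pose V := \matrix_(i < m, j < m) f i j.
have detV_neq0 : \det V != 0.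
  rewrite (_ : V = Vandermonde m (\row_i a i)); last first.
    by apply/matrixP=> i j; rewrite !mxE fE.
  rewrite det_Vandermonde; apply/prodf_neq0=> i _; apply/prodf_neq0=> j lt_ij.
  rewrite !mxE subr_eq0 (inj_eq inj_a); apply: contraTneq lt_ij => ->.
  by rewrite ltnn.
pose W : 'M[R]_(n + m) := \matrix_(i, j)
  if (j < n)%N then (i == m + j :> nat)%N%:R else f i (j - n)%N.
have detW : \det W = (-1) ^+ (m * n) * \det V := det_shift_block R m n f.
pose S := Sylvester_mx p q : 'M_(n + m).
pose T := \matrix_(i < n, j < n) (p`_(m + j - i) *+ (i <= m + j)%N).
pose U := \matrix_(i < m, j < n) (q`_(m + j - i) *+ (i <= m + j)%N).
have evalE (r : {poly R}) (i k N : nat) (x : R) : (size r <= k.+1)%N ->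
    (k + i < N)%N ->
    \sum_(j < N) (r`_(j - i) *+ (i <= j)%N) * x ^+ j = x ^+ i * r.[x].
  move=> sz_r lt_N; rewrite -hornerXn -hornerM mulrC.
  have sz : (size (r * 'X^i)%R <= N)%N.
    apply: leq_trans (size_polyMleq _ _) _.
    by rewrite size_polyXn addnS /= (leq_trans _ lt_N) // -addSn leq_add2r.
  rewrite (horner_coef_wide _ sz); apply: eq_bigr => j _.
  by rewrite coefMXn ltnNge; case: (i <= j)%N.
have evalV N (r : {poly R}) (i k : nat) (j : 'I_m) : (size r <= k.+1)%N ->
    (k + i < N)%N ->
    \sum_(l < N) (r`_(l - i) *+ (i <= l)%N) *
      (if (n + j < n)%N then (l == m + (n + j) :> nat)%N%:R
       else f l (n + j - n)%N) = a j ^+ i * r.[a j].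
  move=> sz_r lt_N; rewrite -(evalE r i k N) //; apply: eq_bigr => l _.
  by rewrite ltnNge leq_addr addKn fE.
have sumE (i : nat) (r : {poly R}) (j : 'I_n) :
    \sum_(k < n + m) (r`_(k - i) *+ (i <= k)%N) *
      (if (j < n)%N then (k == m + j :> nat)%N%:R else f k (j - n)%N) =
    r`_(m + j - i) *+ (i <= m + j)%N.
  have lt_k : (m + j < n + m)%N by rewrite addnC ltn_add2r.
  rewrite (bigD1 (Ordinal lt_k)) //= ltn_ord eqxx mulr1 big1 ?addr0 // => k ne_k.
  rewrite (_ : (_ == _)%N = false) ?mulr0 //.
  by apply/eqP=> e; case/eqP: ne_k; apply/val_inj.
have ES : S *m W = block_mx T 0 U (V *m diag_mx (\row_i q.[a i])).
  apply/matrixP=> i j; rewrite !mxE.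
  under eq_bigr => k _ do rewrite Sylvester_mxE /= [W _ _]mxE.
  rewrite -(splitK i) -(splitK j) !unsplitK; case: (split i) (split j) => k [] l /=.
  - by rewrite row_mxEl mxE (sumE _ p).
  - rewrite row_mxEr mxE (evalV _ p k m) ?(eqP (pa0 l)) ?mulr0 ?sz_p //.
    by rewrite addnC ltn_add2r.
  - by rewrite row_mxEl mxE (sumE _ q).
  - rewrite row_mxEr (evalV _ q k n) ?leqSpred ?ltn_add2l //.
    by rewrite mul_mx_diag !mxE fE.
(* [T] is lower triangular: above the diagonal the index [m + j - i] exceeds the degree [m] of
   [p]. *)
have detT : \det T = lead_coef p ^+ n.
  rewrite det_trig; last first.
    apply/is_trig_mxP=> i j lt_ij; rewrite mxE nth_default ?mul0rn // sz_p.
    lia.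
  rewrite -[n in RHS]card_ord -prodr_const; apply: eq_bigr => i _.
  by rewrite mxE addnK leq_addl.
apply/(mulIf detV_neq0); have /(congr1 determinant) := ES.
rewrite det_mulmx detW det_lblock detT det_mulmx det_diag.
under eq_bigr => i _ do rewrite mxE.
rewrite -/(resultant p q) => E.
set e := (-1) ^+ (m * n) in E *; have e2 : e * e = 1 by rewrite -expr2 sqrr_sign.
transitivity (e * (resultant p q * (e * \det V))).
  by rewrite -[LHS]mul1r -e2; ring.
by rewrite E; ring.
Qed.

Lemma size_deriv_char0 (F : numDomainType) (p : {poly F}) :
  size p^`() = (size p).-1.
Proof.
have [-> | nz_p] := eqVneq p 0; first by rewrite deriv0 size_poly0.
have lt_p' := lt_size_deriv nz_p; apply/eqP.
rewrite eqn_leq -ltnS prednK ?lt_p' ?size_poly_gt0 //=.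
case Dn: (size p) => [|[|n]] //=; rewrite ltnNge.
apply/negP=> le_n; case/negP: nz_p; rewrite -lead_coef_eq0 lead_coefE Dn /=.
have /eqP: p^`()`_n = 0 by rewrite nth_default.
by rewrite coef_deriv mulrn_eq0 /= => ->.
Qed.

(** At a root, the derivative is [c] times the product of the differences to the other roots. With a
    repeated root both sides vanish, so the roots may coincide. *)
Lemma resultant_deriv_prod (F : numFieldType) (c : F) (m : nat)
    (a : 'I_m -> F) (p := c *: \prod_i ('X - (a i)%:P)) : c != 0 ->
  resultant p p^`() =
    c ^+ (m.-1 + m) * \prod_i \prod_(j | j != i) (a i - a j).
Proof.
move=> c0; have sz_p : size p = m.+1.
  by rewrite size_scale // -big_enum size_prod_XsubC size_enum_ord.
have lc_p : lead_coef p = c.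
  by rewrite lead_coefZ (monicP (monic_prod_XsubC _ _ _)) mulr1.
have sz_p' : size p^`() = m by rewrite size_deriv_char0 sz_p.
have pa0 i : root p (a i).
  rewrite rootE hornerZ horner_prod (bigD1 i) //= hornerXsubC subrr.
  by rewrite mul0r mulr0.
have pa' i : p^`().[a i] = c * \prod_(j | j != i) (a i - a j).
  rewrite /p (bigD1 i) //= derivZ derivM derivXsubC !hornerE subrr mul0r addr0.
  by rewrite horner_prod; under eq_bigr => j _ do rewrite hornerXsubC.
have [/injectiveP inj_a | /injectivePn[i [j ne_ij eq_a]]] :=
    boolP (injectiveb a).
  rewrite (resultant_roots _ _ _ _ _ inj_a sz_p pa0) lc_p sz_p'.
  under eq_bigr => i _ do rewrite pa'.
  have ->: (-1) ^+ (m * m.-1) = 1 :> F.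
    by rewrite -signr_odd oddM; case: (m) => //= n; rewrite andNb.
  by rewrite big_split prodr_const card_ord mul1r mulrA -exprD.
have prod0 : \prod_(k | k != i) (a i - a k) = 0.
  by rewrite (bigD1 j) 1?eq_sym //= eq_a subrr mul0r.
rewrite [in RHS](bigD1 i) //= prod0 mul0r mulr0; apply/eqP.
rewrite resultant_eq0 (@root_size_gt1 _ (a i)) //.
  by rewrite gcdp_eq0 negb_and -size_poly_eq0 sz_p.
by rewrite root_gcd pa0 rootE pa' prod0 mulr0 eqxx.
Qed.

(** A morphism from a field preserves sizes, hence the shape of the Sylvester matrix. This moves the
    computation to [algC], where the quadratic factor splits. *)
Lemma map_resultant_field (F : fieldType) (R : nzRingType)
    (f : {rmorphism F -> R}) (p q : {poly F}) :
  f (resultant p q) = resultant (map_poly f p) (map_poly f q).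
Proof.
rewrite /resultant /Sylvester_mx !(size_map_poly f) -det_map_mx /= map_col_mx.
by congr (\det (col_mx _ _)); apply: map_lin1_mx => v;
  rewrite map_poly_rV rmorphM /= map_rVpoly.
Qed.

(** If [z4], [z5] are the roots of the quadratic factor, then [(z4 - z5) ^+ 2] is its discriminant
    and [(r - z4) * (r - z5)] is [g r]. *)
Lemma disc6_split_cubic (a r1 r2 r3 b c : rat)
    (g := fun x : rat => x ^+ 2 + b * x + c) : a != 0 ->
  disc6 (a *: (('X - r1%:P) * ('X - r2%:P) * ('X - r3%:P) *
               ('X^2 + b *: 'X + c%:P))) =
  a ^+ 10 * ((b ^+ 2 - 4%:R * c) *
    ((r1 - r2) * (r1 - r3) * (r2 - r3) * (g r1 * g r2 * g r3)) ^+ 2).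
Proof.
move=> a0; set F := a *: _.
have [z4 [z5 [z45 z45']]] : exists z4 z5 : algC,
    z4 + z5 = - ratr b /\ z4 * z5 = ratr c.
  pose D : algC := ratr b ^+ 2 - 4%:R * ratr c.
  exists ((- ratr b + sqrtC D) / 2%:R), ((- ratr b - sqrtC D) / 2%:R).
  split; first by field.
  by have := sqrtCK D; rewrite /D => e; field: e.
pose z (i : 'I_5) := [:: ratr r1; ratr r2; ratr r3; z4; z5]`_i.
have FE : map_poly ratr F = ratr a *: \prod_i ('X - (z i)%:P).
  rewrite /F !(map_polyZ, rmorphM, rmorphD, rmorphN, rmorph1) /=.
  rewrite !(map_polyX, map_polyC, map_polyXn, rmorphB, map_polyZ, rmorphD) /=.
  rewrite !big_ord_recl big_ord0 /= {}/z /= -z45' -[ratr b]opprK -z45.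
  by congr (_ *: _); rewrite -mul_polyC; ring.
have ra0 : ratr a != 0 :> algC by rewrite fmorph_eq0.
have sz_F : size F = 6%N.
  rewrite -(size_map_poly (@ratr algC)) FE size_scale // -big_enum.
  by rewrite size_prod_XsubC size_enum_ord.
have lc_F : lead_coef F = a.
  apply: (fmorph_inj (@ratr algC)); rewrite -lead_coef_map FE lead_coefZ.
  by rewrite (monicP (monic_prod_XsubC _ _ _)) mulr1.
have res : ratr (resultant F F^`()) = ratr a ^+ 9 *
     \prod_i \prod_(j | j != i) (z i - z j).
  have := resultant_deriv_prod algC (ratr a) 5 z ra0.
  by rewrite /= -FE deriv_map -map_resultant_field.
rewrite /disc6 sz_F /= /disc_poly sz_F lc_F /=.
apply: (fmorph_inj (@ratr algC)).
(* The sign is [(-1) ^+ 10], and [a ^+ 2 / a] leaves one factor [a] besides the [a ^+ 9] of the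
   resultant. *)
transitivity (ratr a * ratr (resultant F F^`()) : algC).
  rewrite -rmorphM; congr ratr. by field.
have gE r : ratr (g r) = (ratr r - z4) * (ratr r - z5) :> algC.
  rewrite /g !(rmorphD, rmorphM, rmorphXn) /= -z45' -[ratr b]opprK -z45.
  by ring.
have DE : ratr (b ^+ 2 - 4%:R * c) = (z4 - z5) ^+ 2 :> algC.
  rewrite !(rmorphB, rmorphM, rmorphXn) /= ratr_nat -z45' -[ratr b]opprK -z45.
  by ring.
rewrite !(rmorphM, rmorphXn) /= DE !gE !rmorphB res.
under [X in _ * (_ * X)]eq_bigr => i _ do rewrite big_mkcond.
rewrite !big_ord_recl !big_ord0 /z /=.
(* Each difference is oriented from lower to higher index and then generalized, so that [ring] sees
   ten independent factors, each squared. *)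
have swap (x y : algC) : x - y = - (y - x) by rewrite opprB.
rewrite (swap z5 z4) !(swap z4 (ratr _)) !(swap z5 (ratr _)).
rewrite (swap (ratr r2) (ratr r1)) !(swap (ratr r3) (ratr _)).
move: (ratr r1 - ratr r2) (ratr r1 - ratr r3) (ratr r2 - ratr r3) (z4 - z5).
move: (ratr r1 - z4) (ratr r2 - z4) (ratr r3 - z4).
move: (ratr r1 - z5) (ratr r2 - z5) (ratr r3 - z5) (ratr a : algC).
by move=> *; ring.
Qed.

(** * Powers of 2 and parity of the scaled roots *)

(** If [p] divided [m], then [p * p] would divide [2 ^ k * p], and the odd [p] would divide [2 ^ k].
    So [m ^ 2] divides [2 ^ k]. *)
Lemma sqr_dvdn_pow2_prime (m k p : nat) : prime p -> odd p ->
  (m ^ 2 %| 2 ^ k * p)%N -> exists2 j, (j.*2 <= k)%N & m = (2 ^ j)%N.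
Proof.
move=> p_pr p_odd dv.
have co2 : coprime p (2 ^ k) by rewrite coprime_sym coprimeXl // coprime2n.
have m0 : (0 < m)%N.
  by case: m dv => //; rewrite dvd0n muln_eq0 expn_eq0 /= => /eqP p0; rewrite p0 in p_pr.
have npm : coprime (m ^ 2) p.
  rewrite coprimeXl // coprime_sym prime_coprime //; apply/negP=> /dvdnP[l lE].
  have : (p * p %| p * 2 ^ k)%N.
    apply: dvdn_trans (_ : p * p %| m ^ 2)%N _; last by rewrite mulnC.
    by rewrite lE expnMn dvdn_mull // dvdnn.
  rewrite dvdn_pmul2l ?prime_gt0 //.
  by move: co2; rewrite prime_coprime // => /negP.
rewrite Gauss_dvdl // in dv.
have dvm : (m %| 2 ^ k)%N by apply: dvdn_trans dv; rewrite dvdn_mulr.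
have [j _ mE] := dvdn_pfactor _ _ (isT : prime 2) dvm.
exists j => //; rewrite -muln2 -(@leq_exp2l 2) // expnM -mE; apply: dvdn_leq => //.
by rewrite expn_gt0.
Qed.

Lemma int_parity (x : int) : exists k, x = 2 * k \/ x = 2 * k + 1.
Proof. by exists (x %/ 2)%Z; lia. Qed.

(* 256 F(s / 4) for F = 4 P + Q^2. *)
Definition quartered_quintic (p0 p1 p2 p3 p4 q0 q1 q2 s : int) : int :=
  s ^+ 5 + 4 * (p4 * s ^+ 4 + 4 * p3 * s ^+ 3 + 16 * p2 * s ^+ 2 + 64 * p1 * s
                + 256 * p0) + (q2 * s ^+ 2 + 4 * q1 * s + 16 * q0) ^+ 2.

(** Let [s = 2 u] with [u] odd. For odd [q2] the square is 16 times an odd number and all other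
    terms are divisible by 32. For even [q2] all terms but [s ^+ 5], which is 32 times an odd
    number, are divisible by 64. *)
Lemma quartered_quintic_root p0 p1 p2 p3 p4 q0 q1 q2 s :
  quartered_quintic p0 p1 p2 p3 p4 q0 q1 q2 s = 0 ->
  (exists k, s = 4 * k) \/ (exists k, s = 2 * k + 1).
Proof.
rewrite /quartered_quintic; have [k [->|->]] := int_parity s; last by right; exists k.
have [t [->|->]] := int_parity k; first by left; exists t; ring.
have [l [->|->]] := int_parity q2; lia.
Qed.

(* Since |a1 a3| <= x y (x + y) / 4, the left-hand side of the last equation is
   at most x y (x + y) max(x, y) + 4 min(x, y) in absolute value. *)
Lemma no_odd_multiple (x y a1 a2 a3 o : int) : 0 < x -> 0 < y -> 
  (exists k, o = 2 * k + 1) ->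
  4 * `|a1 * a2 * a3| = x * y * (x + y) ->
  4 * (a3 * x - a1 * y) = x * y * (x + y) ^+ 2 * o -> False.
Proof.
move=> x0 y0 [k ok] e1 e2.
have V0 : 0 < x * y * (x + y) by rewrite !mulr_gt0 // addr_gt0.
have a_neq0 : a1 * a2 * a3 != 0 by apply: contraTneq V0 => e; rewrite -e1 e; lia.
have [[a1n a2n] a3n] : (a1 != 0 /\ a2 != 0) /\ a3 != 0.
  by move: a_neq0; rewrite !mulf_eq0 !negb_or => /andP[/andP[-> ->] ->].
have o1 : 1 <= `|o| by lia.
have g1 : 1 <= `|a1| by lia.
have g2 : 1 <= `|a2| by lia.
have g3 : 1 <= `|a3| by lia.
rewrite !normrM in e1.
have e3 : x * y * (x + y) ^+ 2 <= 4 * (`|a3| * x + `|a1| * y).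
  have := congr1 Num.norm e2; rewrite !normrM.
  rewrite (gtr0_norm x0) (gtr0_norm y0) (gtr0_norm (addr_gt0 x0 y0)) => e4.
  have : `|a3 * x - a1 * y| <= `|a3| * x + `|a1| * y.
    by rewrite (le_trans (ler_normB _ _)) // !normrM (gtr0_norm x0) (gtr0_norm y0).
  have : x * y * (x + y) ^+ 2 <= x * y * (x + y) ^+ 2 * `|o|.
    rewrite ler_peMr //; apply: mulr_ge0 (sqr_ge0 _).
    by rewrite mulr_ge0 // ltW.
  lia.
move: {e2 a_neq0 a1n a2n a3n} `|a1| `|a2| `|a3| g1 g2 g3 e1 e3 => b1 b2 b3 g1 g2 g3 e1 e3.
have {g2 e1} e1 : 4 * (b1 * b3) <= x * y * (x + y).
  rewrite -e1 ler_pM2l // mulrAC ler_peMr //; nia.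
(* The product is 2 at [x = y = 1] and at least 6 otherwise. *)
have V4 : x * y * (x + y) != 4.
  have [x2|x2] := leP 2 x; have [y2|y2] := leP 2 y; nia.
have e4 : b1 + b3 <= b1 * b3 + 1 by nia.
set V := x * y * (x + y) in V0 V4 e1.
have {}e3 : V * (x + y) <= 4 * (b3 * x + b1 * y) by rewrite /V; lia.
(* For [x <= y], [e3], [e4] and [e1] give [V * (x + y) <= V * y + 4 * x], so [V <= 4]; but [e1] also
   gives [4 <= V], and [V4] excludes equality. The other case is symmetric. *)
have [xy|xy] := leP x y; nia.
Qed.

Lemma odd_dvd_pow2 (d : int) (j : nat) :
  (exists k, d = 2 * k + 1) -> (`|d| %| 2 ^ j)%N -> d = 1 \/ d = -1.
Proof.
move=> [k dk] /(dvdn_pfactor _ _ (isT : prime 2))[[|i] _ e]; first by lia.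
by rewrite expnS in e; lia.
Qed.

(** By hypothesis [(u - s1)(u - s2)(u - s3)(u^2 + B u + C)] has even coefficients in degrees 0 to 3.
    Modulo 2 it is [u^4 (u + e)] for some [e], where 1 is at most a simple root. *)
Lemma at_most_one_odd (s1 s2 s3 B C a3 a2 a1 a0 : int) :
  C - (s1 + s2 + s3) * B + (s1 * s2 + s1 * s3 + s2 * s3) = 2 * a3 ->
  - (s1 + s2 + s3) * C + (s1 * s2 + s1 * s3 + s2 * s3) * B - s1 * s2 * s3
    = 2 * a2 ->
  (s1 * s2 + s1 * s3 + s2 * s3) * C - s1 * s2 * s3 * B = 2 * a1 ->
  - s1 * s2 * s3 * C = 2 * a0 ->
  (exists k, s1 = 2 * k + 1) -> (exists k, s2 = 2 * k + 1) -> False.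
Proof.
move=> h3 h2 h1 h0 [k1 e1] [k2 e2]; subst.
have [k3 [?|?]] := int_parity s3; have [b [?|?]] := int_parity B;
  have [c [?|?]] := int_parity C; subst; lia.
Qed.

(* The left-hand side is 64 F'(r) with F' = 4 P' + 2 Q Q', and
   Q(r) is even because Q(r)^2 = - 4 P(r). *)
Lemma deriv_at_root_dvd (p0 p1 p2 p3 p4 q0 q1 q2 r s2 s3 B C : int) (s1 := 4 * r) :
  quartered_quintic p0 p1 p2 p3 p4 q0 q1 q2 s1 = 0 ->
  B - (s1 + s2 + s3) = 4 * p4 + q2 ^+ 2 ->
  C - (s1 + s2 + s3) * B + (s1 * s2 + s1 * s3 + s2 * s3)
    = 16 * p3 + 8 * (q1 * q2) ->
  - (s1 + s2 + s3) * C + (s1 * s2 + s1 * s3 + s2 * s3) * B - s1 * s2 * s3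
    = 16 * (4 * p2 + q1 ^+ 2 + 2 * (q2 * q0)) ->
  (s1 * s2 + s1 * s3 + s2 * s3) * C - s1 * s2 * s3 * B
    = 128 * (2 * p1 + q1 * q0) ->
  exists A, (s1 - s2) * (s1 - s3) * (s1 ^+ 2 + B * s1 + C) = 256 * A.
Proof.
move=> h h4 h3 h2 h1.
have [t tE] : exists t, q2 * r ^+ 2 + q1 * r + q0 = 2 * t.
  have [t [tE|tE]] := int_parity (q2 * r ^+ 2 + q1 * r + q0); first by exists t.
  exfalso; suff : 4 * (r ^+ 5 + p4 * r ^+ 4 + p3 * r ^+ 3 + p2 * r ^+ 2 + p1 * r
               + p0) + (q2 * r ^+ 2 + q1 * r + q0) ^+ 2 = 0 by rewrite tE; lia.
  apply: (mulfI (_ : 256 != 0 :> int)) => //; rewrite mulr0 -h.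
  by rewrite /quartered_quintic /s1; ring.
(* This is [P'(r) + t Q'(r)], with [2 t] expanded as [Q(r)] in the term [2 q2 r t]. *)
exists (5 * r ^+ 4 + r ^+ 3 * (4 * p4 + q2 ^+ 2) + 3 * r ^+ 2 * p3 + 2 * r * p2 +
  p1 + r ^+ 2 * q1 * q2 + r * q2 * q0 + q1 * t).
have -> : (s1 - s2) * (s1 - s3) * (s1 ^+ 2 + B * s1 + C) =
  5 * s1 ^+ 4 + 4 * s1 ^+ 3 * (B - (s1 + s2 + s3)) +
  3 * s1 ^+ 2 * (C - (s1 + s2 + s3) * B + (s1 * s2 + s1 * s3 + s2 * s3)) +
  2 * s1 * (- (s1 + s2 + s3) * C + (s1 * s2 + s1 * s3 + s2 * s3) * B
            - s1 * s2 * s3) +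
  ((s1 * s2 + s1 * s3 + s2 * s3) * C - s1 * s2 * s3 * B) by ring.
rewrite h4 h3 h2 h1 /s1.
have -> : 256 * (5 * r ^+ 4 + r ^+ 3 * (4 * p4 + q2 ^+ 2) + 3 * r ^+ 2 * p3 +
    2 * r * p2 + p1 + r ^+ 2 * q1 * q2 + r * q2 * q0 + q1 * t) =
  256 * (5 * r ^+ 4 + r ^+ 3 * (4 * p4 + q2 ^+ 2) + 3 * r ^+ 2 * p3 +
    2 * r * p2 + p1 + r ^+ 2 * q1 * q2 + r * q2 * q0) + 128 * q1 * (2 * t) by ring.
by rewrite -tE; ring.
Qed.

Lemma roots_dvd4 (s1 s2 s3 : int) (j : nat) (odd_int := fun s => exists k, s = 2 * k + 1)
    (dvd4 := fun s => exists k, s = 4 * k) :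
  dvd4 s1 \/ odd_int s1 -> dvd4 s2 \/ odd_int s2 -> dvd4 s3 \/ odd_int s3 ->
  s1 < s2 -> s2 < s3 ->
  (absz (s1 - s2) %| 2 ^ j)%N -> (absz (s1 - s3) %| 2 ^ j)%N ->
  (absz (s2 - s3) %| 2 ^ j)%N ->
  (odd_int s1 -> odd_int s2 -> False) -> (odd_int s1 -> odd_int s3 -> False) ->
  (odd_int s2 -> odd_int s3 -> False) ->
  [/\ dvd4 s1, dvd4 s2 & dvd4 s3].
Proof.
move=> sh1 sh2 sh3 lt12 lt23 dv12 dv13 dv23 no12 no13 no23.
have {}dv12 k : s1 - s2 = 2 * k + 1 -> s1 - s2 = 1 \/ s1 - s2 = -1.
  by move=> e; apply: odd_dvd_pow2 dv12; exists k.
have {}dv13 k : s1 - s3 = 2 * k + 1 -> s1 - s3 = 1 \/ s1 - s3 = -1.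
  by move=> e; apply: odd_dvd_pow2 dv13; exists k.
have {}dv23 k : s2 - s3 = 2 * k + 1 -> s2 - s3 = 1 \/ s2 - s3 = -1.
  by move=> e; apply: odd_dvd_pow2 dv23; exists k.
case: sh1 sh2 sh3 => [d1|o1] [d2|o2] [d3|o3] //.
- case: d1 d2 o3 => [k1 e1] [k2 e2] [k3 e3].
  (* The arguments write the odd differences as [2 k + 1]. Both being 1 or -1, the other two roots
     would be distinct multiples of 4 at distance at most 2. *)
  have := dv13 (2 * k1 - k3 - 1); have := dv23 (2 * k2 - k3 - 1).
  clear -lt12 lt23 e1 e2 e3; lia.
- case: d1 o2 d3 => [k1 e1] [k2 e2] [k3 e3].
  have := dv12 (2 * k1 - k2 - 1); have := dv23 (k2 - 2 * k3).
  clear -lt12 lt23 e1 e2 e3; lia.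
- by case: (no23 o2 o3).
- case: o1 d2 d3 => [k1 e1] [k2 e2] [k3 e3].
  have := dv12 (k1 - 2 * k2); have := dv13 (k1 - 2 * k3).
  clear -lt12 lt23 e1 e2 e3; lia.
- by case: (no13 o1 o3).
- by case: (no12 o1 o2).
- by case: (no12 o1 o2).
Qed.

(** * The statement over the integers *)

(** The equations [h4] to [h0] compare the coefficients of [(u - s1)(u - s2)(u - s3)(u^2 + B u + C)]
    with those of [256 F(u / 4)]. *)
Lemma no_odd_prime_disc (p0 p1 p2 p3 p4 q0 q1 q2 s1 s2 s3 B C : int) (p : nat) :
  s1 < s2 -> s2 < s3 ->
  quartered_quintic p0 p1 p2 p3 p4 q0 q1 q2 s1 = 0 ->
  quartered_quintic p0 p1 p2 p3 p4 q0 q1 q2 s2 = 0 ->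
  quartered_quintic p0 p1 p2 p3 p4 q0 q1 q2 s3 = 0 ->
  B - (s1 + s2 + s3) = 4 * p4 + q2 ^+ 2 ->
  C - (s1 + s2 + s3) * B + (s1 * s2 + s1 * s3 + s2 * s3)
    = 16 * p3 + 8 * (q1 * q2) ->
  - (s1 + s2 + s3) * C + (s1 * s2 + s1 * s3 + s2 * s3) * B - s1 * s2 * s3
    = 16 * (4 * p2 + q1 ^+ 2 + 2 * (q2 * q0)) ->
  (s1 * s2 + s1 * s3 + s2 * s3) * C - s1 * s2 * s3 * B
    = 128 * (2 * p1 + q1 * q0) ->
  - s1 * s2 * s3 * C = 256 * (4 * p0 + q0 ^+ 2) ->
  prime p -> odd p ->
  absz ((B ^+ 2 - 4 * C) * ((s1 - s2) * (s1 - s3) * (s2 - s3) *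
     ((s1 ^+ 2 + B * s1 + C) * (s2 ^+ 2 + B * s2 + C) *
      (s3 ^+ 2 + B * s3 + C))) ^+ 2) <> (2 ^ 32 * p)%N.
Proof.
move=> lt12 lt23 r1 r2 r3 h4 h3 h2 h1 h0 p_pr p_odd hD.
set M := (X in _ * X ^+ 2) in hD.
have [j _ Mj] : exists2 j, (j.*2 <= 32)%N & absz M = (2 ^ j)%N.
  by apply: (sqr_dvdn_pow2_prime _ _ p) => //; rewrite -hD abszM abszX dvdn_mull.
have dv12 : (absz (s1 - s2) %| 2 ^ j)%N.
  rewrite -Mj /M !abszM -!mulnA.
  exact: dvdn_mulr.
have dv13 : (absz (s1 - s3) %| 2 ^ j)%N.
  rewrite -Mj /M !abszM -!mulnA.
  exact/dvdn_mull/dvdn_mulr.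
have dv23 : (absz (s2 - s3) %| 2 ^ j)%N.
  rewrite -Mj /M !abszM -!mulnA.
  exact/dvdn_mull/dvdn_mull/dvdn_mulr.
have [[t1 e1] [t2 e2] [t3 e3]] :
    [/\ exists k, s1 = 4 * k, exists k, s2 = 4 * k & exists k, s3 = 4 * k].
  have [c3 [c2 [c1 [c0 [g3 g2 g1 g0]]]]] : exists c3 c2 c1 c0, [/\
    C - (s1 + s2 + s3) * B + (s1 * s2 + s1 * s3 + s2 * s3) = 2 * c3,
    - (s1 + s2 + s3) * C + (s1 * s2 + s1 * s3 + s2 * s3) * B - s1 * s2 * s3
      = 2 * c2,
    (s1 * s2 + s1 * s3 + s2 * s3) * C - s1 * s2 * s3 * B = 2 * c1 &
    - s1 * s2 * s3 * C = 2 * c0].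
    exists (8 * p3 + 4 * (q1 * q2)), (8 * (4 * p2 + q1 ^+ 2 + 2 * (q2 * q0))),
      (64 * (2 * p1 + q1 * q0)), (128 * (4 * p0 + q0 ^+ 2)).
    by rewrite h3 h2 h1 h0; split; ring.
  apply: (roots_dvd4 s1 s2 s3 j (quartered_quintic_root _ _ _ _ _ _ _ _ _ r1)
    (quartered_quintic_root _ _ _ _ _ _ _ _ _ r2)
    (quartered_quintic_root _ _ _ _ _ _ _ _ _ r3)) => //.
  - exact: (at_most_one_odd s1 s2 s3 B C c3 c2 c1 c0).
  (* The relations are symmetric in the roots, so the other pairs follow by permutation. *)
  - by apply: (at_most_one_odd s1 s3 s2 B C c3 c2 c1 c0);
      rewrite -?g3 -?g2 -?g1 -?g0; ring.
  - by apply: (at_most_one_odd s2 s3 s1 B C c3 c2 c1 c0);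
      rewrite -?g3 -?g2 -?g1 -?g0; ring.
have [q [q2E|q2E]] := int_parity q2.
  have [b Bb] : exists b, B = 4 * b.
    by exists (t1 + t2 + t3 + p4 + q ^+ 2); rewrite e1 e2 e3 q2E in h4; clear -h4; lia.
  have [c Cc] : exists c, C = 16 * c.
    exists ((t1 + t2 + t3) * b - (t1 * t2 + t1 * t3 + t2 * t3) + p3 + q1 * q).
    rewrite e1 e2 e3 q2E Bb in h3; clear -h3; lia.
  (* [B ^+ 2 - 4 * C] contributes [2 ^ 4]. In [M], three differences give 4 each and three values
     give 16 each, so its square contributes [2 ^ 36]. *)
  have : (2 ^ 40 %| 2 ^ 32 * p)%N.
    rewrite -hD /M e1 e2 e3 Bb Cc.
    apply/dvdnP; exists (absz ((b ^+ 2 - 4 * c) * ((t1 - t2) * (t1 - t3) * (t2 - t3) *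
     ((t1 ^+ 2 + b * t1 + c) * (t2 ^+ 2 + b * t2 + c) *
      (t3 ^+ 2 + b * t3 + c))) ^+ 2)).
    have -> : (2 ^ 40 = absz (2 ^+ 40 : int))%N by rewrite abszX.
    by rewrite mulnC -abszM; congr absz; ring.
  rewrite -[40%N]/(32 + 8)%N expnD dvdn_pmul2l ?expn_gt0 //.
  by move/(dvdn_trans (isT : (2 %| 2 ^ 8)%N)); rewrite dvdn2 p_odd.
have [d dE] : exists d, B = 2 * d + 1.
  exists (2 * (t1 + t2 + t3) + 2 * p4 + 2 * q ^+ 2 + 2 * q).
  by rewrite e1 e2 e3 q2E in h4; clear -h4; lia.
(* As [B ^+ 2 - 4 * C] and [p] are odd, the 2-adic valuation of [hD] reads [j * 2 = 32]. *)
have j16 : (2 ^ j = 2 ^ 16)%N.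
  have oD : odd (absz (B ^+ 2 - 4 * C)%R) by clear -dE; rewrite dE; lia.
  have pow0 n : (0 < 2 ^ n)%N by rewrite expn_gt0.
  have log2 n : odd n -> logn 2 n = 0%N by rewrite -coprime2n; apply: logn_coprime.
  have := congr1 (logn 2) hD; rewrite abszM abszX Mj -expnM.
  rewrite (lognM 2 (odd_gt0 oD) (pow0 _)) (lognM 2 (pow0 _) (prime_gt0 p_pr)).
  rewrite !(pfactorK _ (isT : prime 2)) !log2 // add0n addn0 => jE.
  by have -> : j = 16%N by clear -jE; lia.
have [A1 E1] := deriv_at_root_dvd p0 p1 p2 p3 p4 q0 q1 q2 t1 s2 s3 B C
  ltac:(by rewrite -e1) ltac:(rewrite -e1 -h4; ring)
  ltac:(rewrite -e1 -h3; ring) ltac:(rewrite -e1 -h2; ring)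
  ltac:(rewrite -e1 -h1; ring).
have [A2 E2] := deriv_at_root_dvd p0 p1 p2 p3 p4 q0 q1 q2 t2 s1 s3 B C
  ltac:(by rewrite -e2) ltac:(rewrite -e2 -h4; ring)
  ltac:(rewrite -e2 -h3; ring) ltac:(rewrite -e2 -h2; ring)
  ltac:(rewrite -e2 -h1; ring).
have [A3 E3] := deriv_at_root_dvd p0 p1 p2 p3 p4 q0 q1 q2 t3 s1 s2 B C
  ltac:(by rewrite -e3) ltac:(rewrite -e3 -h4; ring)
  ltac:(rewrite -e3 -h3; ring) ltac:(rewrite -e3 -h2; ring)
  ltac:(rewrite -e3 -h1; ring).
have x0 : 0 < t2 - t1 by clear -lt12 e1 e2; lia.
have y0 : 0 < t3 - t2 by clear -lt23 e2 e3; lia.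
(* The odd factor is [s1 + s3 + B], the divided difference of [g(u) = u^2 + B u + C] at [s1] and
   [s3]; it appears because [A3 x - A1 y] is a multiple of [g(s3) - g(s1)]. *)
apply: (no_odd_multiple (t2 - t1) (t3 - t2) A1 A2 A3 (4 * (t1 + t3) + B) x0 y0).
- by exists (2 * (t1 + t3) + d); rewrite dE; ring.
- have V0 : 0 < (t2 - t1) * (t3 - t2) * (t2 - t1 + (t3 - t2)).
    exact: mulr_gt0 (mulr_gt0 x0 y0) (addr_gt0 x0 y0).
  set V := (X in _ = X) in V0 *.
  have hM : `|M| = 2 ^+ 16 :> int by rewrite -abszE Mj j16 -natrX natz.
  apply: (mulfI (_ : 2 ^+ 22 != 0 :> int)); first exact: expf_neq0.
  (* The product of the three derivatives contains each root difference twice: one copy lies in [M],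
     the other gives [2 ^+ 6 * V], up to sign. *)
  have : 2 ^+ 24 * (A1 * A2 * A3) = 2 ^+ 6 * M * V.
    transitivity ((256 * A1) * (256 * A2) * (256 * A3)); first by ring.
    by rewrite -E1 -E2 -E3 /M /V e1 e2 e3; ring.
  move/(congr1 Num.norm); rewrite (normrM (2 ^+ 24)) (normrM (2 ^+ 6 * M)).
  rewrite (normrM (2 ^+ 6)) hM (gtr0_norm V0) !normrX !normr_nat => E.
  move: `|A1 * A2 * A3| E => a E; transitivity (2 ^+ 24 * a); first by ring.
  by apply: (etrans E); rewrite /V; ring.
- apply: (mulfI (_ : 256 != 0 :> int)) => //.
  have -> : 256 * (4 * (A3 * (t2 - t1) - A1 * (t3 - t2))) =
    4 * ((256 * A3) * (t2 - t1) - (256 * A1) * (t3 - t2)) by ring.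
  by rewrite -E1 -E3 e1 e2 e3; ring.
Qed.

(** * Rational roots and the cubic factor *)

(** Seen in [algC], [x] is a rational algebraic integer, hence an integer. *)
Lemma monic_int_rat_root (n : nat) (g : nat -> int) (x : rat) : g n = 1 ->
  \sum_(i < n.+1) (g i)%:~R * x ^+ i = 0 -> exists s : int, x = s%:~R.
Proof.
move=> gn gx0; pose G := \poly_(i < n.+1) (g i)%:~R : {poly algC}.
have monG : G \is monic by rewrite monicE lead_coef_poly ?gn ?oner_eq0.
have intG : G \is a polyOver Num.int.
  by apply/polyOver_poly=> i _; rewrite rpred_int.
have Gx0 : root G (ratr x).
  rewrite rootE horner_poly; apply/eqP.
  rewrite -[RHS](rmorph0 (@ratr algC)) -gx0 rmorph_sum /=.
  by apply: eq_bigr => i _; rewrite rmorphM rmorphXn /= ratr_int.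
have /intrP[s xs] := Cint_rat_Aint (Crat_rat x) (@root_monic_Aint _ _ Gx0 monG intG).
exists s; apply: (fmorph_inj (@ratr algC)); exact: etrans xs (esym (ratr_int _ s)).
Qed.

Lemma int_coef (P Q : {poly rat}) (i : nat) : integral_eq P Q ->
  exists p q : int, P`_i = p%:~R /\ Q`_i = q%:~R.
Proof.
move=> /(_ i)[dP dQ]; exists (numq P`_i), (numq Q`_i).
by rewrite !numqE dP dQ !mulr1.
Qed.

(** In degree 5 one Weierstrass point is at infinity, leaving three affine ones. Each has
    [y = - Q(x) / 2], so it is determined by [x], and [4 P + Q^2 = (2 y + Q)^2] vanishes there. *)
Lemma sorted_rat_roots (P Q : {poly rat}) :
  num_rat_wpts_is P Q 4 -> size (4%:R *: P + Q ^+ 2) = 6%N ->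
  exists x1 x2 x3, [/\ x1 < x2, x2 < x3 &
    all (root (4%:R *: P + Q ^+ 2)) [:: x1; x2; x3]].
Proof.
case=> s [uniq_s mem_s]; rewrite /n_wpt_infty => sz_s sz_F.
rewrite sz_F eqxx addn1 in sz_s; case: sz_s => sz_s.
have ptE pt : pt \in s -> pt.2 = - Q.[pt.1] / 2%:R /\ root (4%:R *: P + Q ^+ 2) pt.1.
  rewrite mem_s => /andP[/eqP Ept /eqP Ey].
  have y2 : Q.[pt.1] = - 2%:R * pt.2 by lra.
  split; first by rewrite y2; field.
  by rewrite rootE !hornerE -Ept y2; apply/eqP; ring.
have uniq_x : uniq (map fst s).
  rewrite map_inj_in_uniq // => -[x y] [x' y'] /ptE[/= -> _] /ptE[/= -> _].
  by move=> ->.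
have := sort_lt_sorted (map fst s); rewrite uniq_x.
have := size_sort <=%R (map fst s); rewrite size_map sz_s.
have : all (root (4%:R *: P + Q ^+ 2)) (sort <=%R (map fst s)).
  by apply/allP=> x; rewrite mem_sort => /mapP[pt /ptE[_ rt] ->].
case: (sort _ _) => [|x1 [|x2 [|x3 [|]]]] //= rts _ /and3P[lt12 lt23 _].
by exists x1, x2, x3.
Qed.

Lemma split_cubic (F : {poly rat}) (a x1 x2 x3 : rat) : a != 0 ->
  size F = 6%N -> lead_coef F = a -> x1 < x2 -> x2 < x3 ->
  all (root F) [:: x1; x2; x3] ->
  exists b c, F = a *: (('X - x1%:P) * ('X - x2%:P) * ('X - x3%:P) *
               ('X^2 + b *: 'X + c%:P)).
Proof.
move=> a0 sz_F lc_F lt12 lt23 rts.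
have uniq_x : uniq_roots [:: x1; x2; x3].
  rewrite uniq_rootsE /= !inE !negb_or !(lt_eqF lt12) (lt_eqF lt23).
  by rewrite (lt_eqF (lt_trans lt12 lt23)).
have [q Fq] := uniq_roots_prod_XsubC rts uniq_x.
have mon := monic_prod_XsubC [:: x1; x2; x3] xpredT id.
have q0 : q != 0 by apply: contra_eq_neq sz_F => q0; rewrite Fq q0 mul0r size_poly0.
have sz_q : size q = 3%N.
  by move: sz_F; rewrite Fq size_Mmonic // size_prod_XsubC /= addn4 /= => -[].
have lc_q : q`_2 = a.
  by rewrite -lc_F Fq lead_coef_Mmonic // lead_coefE sz_q.
exists (q`_1 / a), (q`_0 / a).
rewrite Fq !big_cons big_nil mulr1 -{1}[q]coefK sz_q poly_def.
rewrite !big_ord_recl big_ord0 /= lc_q.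
have -> : q`_1 = a * (q`_1 / a) by field.
have -> : q`_0 = a * (q`_0 / a) by field.
rewrite ![a * (_ / a) / a](mulrC _ a^-1) !mulKf // -!mul_polyC. 
by ring.
Qed.

Lemma absz_scaled (X : int) (w : rat) (n k p : nat) :
  X%:~R = n%:R ^+ k * w -> `|w| = p%:R -> absz X = (n ^ k * p)%N.
Proof.
move=> XE wE; apply/eqP; rewrite -(eqr_nat rat) natr_absz intr_norm XE normrM wE.
by rewrite normrX normr_nat natrM natrX.
Qed.

(** * From the curve to the integer statement *)

Theorem theorem5p1 (P Q : {poly rat}) :
  genus2_eq P Q ->
  num_rat_wpts_is P Q 4 ->
  integral_eq P Q ->
  P \is monic -> size P = 6%N -> (size Q <= 3)%N ->
  globally_minimal P Q ->
  ~ (exists p : nat, [/\ prime p, odd p & `|wdisc P Q| = p%:R]).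
Proof.
move=> _ wpts PQint monP szP szQ _ [p [p_pr p_odd discE]].
have [p0 [q0 [P0 Q0]]] := int_coef P Q 0 PQint.
have [p1 [q1 [P1 Q1]]] := int_coef P Q 1 PQint.
have [p2 [q2 [P2 Q2]]] := int_coef P Q 2 PQint.
have [p3 [_ [P3 _]]] := int_coef P Q 3 PQint.
have [p4 [_ [P4 _]]] := int_coef P Q 4 PQint.
have P5 : P`_5 = 1 by have := monicP monP; rewrite lead_coefE szP.
have PE x : P.[x] = x ^+ 5 + p4%:~R * x ^+ 4 + p3%:~R * x ^+ 3 + p2%:~R * x ^+ 2
                    + p1%:~R * x + p0%:~R.
  rewrite horner_coef szP !big_ord_recl big_ord0 /= /bump /=.
  by rewrite P0 P1 P2 P3 P4 P5; ring.
have QE x : Q.[x] = q2%:~R * x ^+ 2 + q1%:~R * x + q0%:~R.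
  rewrite (horner_coef_wide _ szQ) !big_ord_recl big_ord0 /= /bump /=.
  by rewrite Q0 Q1 Q2; ring.
pose F := 4%:R *: P + Q ^+ 2.
have FE x : F.[x] = 4%:R * P.[x] + Q.[x] ^+ 2 by rewrite !hornerE.
have n4 : 4%:R != 0 :> rat by [].
have szP4 : size (4%:R *: P) = 6%N by rewrite size_scale.
have lt_szQ : (size (Q ^+ 2)%R < size (4%:R *: P)%R)%N.
  rewrite szP4 ltnS (leq_trans (size_poly_exp_leq _ _)) //.
  by case: (size Q) szQ => [|[|[|[|]]]].
have szF : size F = 6%N by rewrite size_polyDl.
have lcF : lead_coef F = 4%:R.
  by rewrite lead_coefDl // lead_coefZ (monicP monP) mulr1.
have [x1 [x2 [x3 [lt12 lt23 rts]]]] := sorted_rat_roots P Q wpts szF.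
have [b [c Fbc]] := split_cubic F _ x1 x2 x3 n4 szF lcF lt12 lt23 rts.
have scale_root x : F.[x] = 0 -> exists s : int, 4%:R * x = s%:~R.
  (* The list holds the coefficients of the monic integer polynomial [256 F(u / 4)], taken at
     [u = 4 x]. *)
  move=> Fx0; apply: (monic_int_rat_root 5 (nth 0 [:: 256 * (4 * p0 + q0 ^+ 2);
    128 * (2 * p1 + q1 * q0); 16 * (4 * p2 + q1 ^+ 2 + 2 * (q2 * q0));
    16 * p3 + 8 * (q1 * q2); 4 * p4 + q2 ^+ 2; 1])) => //.
  rewrite !big_ord_recl big_ord0 /= /bump /=.
  transitivity (256%:R * F.[x]); last by rewrite Fx0 mulr0.
  by rewrite FE PE QE; ring.
case/and4P: rts => /rootP Fx1 /rootP Fx2 /rootP Fx3 _.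
have [s1 s1E] := scale_root x1 Fx1.
have [s2 s2E] := scale_root x2 Fx2.
have [s3 s3E] := scale_root x3 Fx3.
have ev t : 4%:R * (t ^+ 5 + p4%:~R * t ^+ 4 + p3%:~R * t ^+ 3 + p2%:~R * t ^+ 2
                    + p1%:~R * t + p0%:~R) + (q2%:~R * t ^+ 2 + q1%:~R * t + q0%:~R) ^+ 2
     = 4%:R * ((t - x1) * (t - x2) * (t - x3) * (t ^+ 2 + b * t + c)).
  by rewrite -PE -QE -FE Fbc !hornerE.
have div4 (x : rat) (s : int) : 4%:R * x = s%:~R -> x = s%:~R / 4%:R.
  by move=> <-; field.
have [x1E x2E x3E] := And3 (div4 _ _ s1E) (div4 _ _ s2E) (div4 _ _ s3E).
(* Comparing values at five points gives the linear relations between the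
   coefficients of both sides of ev. *)
have [B Bdef] : exists B : int, B = 4 * p4 + q2 ^+ 2 + (s1 + s2 + s3) by eexists.
have bE : b = B%:~R / 4%:R.
  rewrite Bdef; move: ev; rewrite x1E x2E x3E => ev.
  have := ev 0; have := ev 1; have := ev (-1); have := ev 2; have := ev (-2).
  clear; lra.
have [C Cdef] : exists C : int, C = 16 * p3 + 8 * (q1 * q2) + (s1 + s2 + s3) * B
                - (s1 * s2 + s1 * s3 + s2 * s3) by eexists.
have cE : c = C%:~R / 16%:R.
  rewrite Cdef; move: ev; rewrite x1E x2E x3E bE => ev.
  have := ev 0; have := ev 1; have := ev (-1); have := ev 2; have := ev (-2).
  clear; lra.
have root_int (s : int) (x : rat) : 4%:R * x = s%:~R -> F.[x] = 0 ->
    quartered_quintic p0 p1 p2 p3 p4 q0 q1 q2 s = 0.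
  move=> /div4 -> Fx0; apply: (intr_inj (R := rat)).
  transitivity (256%:R * F.[s%:~R / 4%:R]); last by rewrite Fx0 mulr0.
  by rewrite FE PE QE /quartered_quintic; field.
have gE (s : int) (x : rat) : 4%:R * x = s%:~R ->
    (s ^+ 2 + B * s + C)%:~R = 16%:R * (x ^+ 2 + b * x + c).
  by move=> /div4 ->; rewrite bE cE; field.
have dE (s t : int) (x y : rat) : 4%:R * x = s%:~R -> 4%:R * y = t%:~R ->
    (s - t)%:~R = 4%:R * (x - y).
  by move=> /div4 -> /div4 ->; field.
have lts (s t : int) (x y : rat) :
    4%:R * x = s%:~R -> 4%:R * y = t%:~R -> x < y -> s < t.
  by move=> sE tE lt_xy; rewrite -(ltr_int rat) -sE -tE ltr_pM2l.
apply: (no_odd_prime_disc p0 p1 p2 p3 p4 q0 q1 q2 s1 s2 s3 B C p).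
- exact: lts s1E s2E lt12.
- exact: lts s2E s3E lt23.
- exact: root_int s1E Fx1.
- exact: root_int s2E Fx2.
- exact: root_int s3E Fx3.
- by rewrite Bdef; ring.
- by rewrite Cdef; ring.
- apply: (intr_inj (R := rat)); move: ev; rewrite x1E x2E x3E bE cE => ev.
  have := ev 0; have := ev 1; have := ev (-1); have := ev 2; have := ev (-2).
  clear; lra.
- apply: (intr_inj (R := rat)); move: ev; rewrite x1E x2E x3E bE cE => ev.
  have := ev 0; have := ev 1; have := ev (-1); have := ev 2; have := ev (-2).
  clear; lra.
- apply: (intr_inj (R := rat)); move: ev; rewrite x1E x2E x3E bE cE => ev.
  have := ev 0; have := ev 1; have := ev (-1); have := ev 2; have := ev (-2).
  clear; lra.
- exact: p_pr.
- exact: p_odd.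
have [d def_d] : exists d : rat, d = b ^+ 2 - 4%:R * c by eexists.
have [m mE] : exists m : rat, m = (x1 - x2) * (x1 - x3) * (x2 - x3) *
    ((x1 ^+ 2 + b * x1 + c) * (x2 ^+ 2 + b * x2 + c) * (x3 ^+ 2 + b * x3 + c)).
  by eexists.
have discF : disc6 F = 4%:R ^+ 10 * (d * m ^+ 2).
  by rewrite def_d mE Fbc; exact: disc6_split_cubic.
have DE : (B ^+ 2 - 4 * C)%:~R = 16%:R * d.
  by rewrite def_d bE cE; field.
(* Three differences scale by 4 and three values by 16, in all by [2 ^+ 18]. *)
have ME : ((s1 - s2) * (s1 - s3) * (s2 - s3) * ((s1 ^+ 2 + B * s1 + C) *
    (s2 ^+ 2 + B * s2 + C) * (s3 ^+ 2 + B * s3 + C)))%:~R = 2 ^+ 18 * m :> rat.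
  rewrite !intrM (dE _ _ _ _ s1E s2E) (dE _ _ _ _ s1E s3E) (dE _ _ _ _ s2E s3E).
  rewrite (gE _ _ s1E) (gE _ _ s2E) (gE _ _ s3E) mE.
  move: (x1 - x2) (x1 - x3) (x2 - x3) (x1 ^+ 2 + _) (x2 ^+ 2 + _) (x3 ^+ 2 + _).
  by move=> *; ring.
move: (B ^+ 2 - 4 * C) ((s1 - s2) * _ * _ * _) DE ME => D M DE ME.
(* The left side is [2 ^+ 40 * d * m ^+ 2], while [wdisc P Q] is
   [4 ^+ 10 * d * m ^+ 2 / 2 ^+ 12]. *)
have XE : (D * M ^+ 2)%:~R = 2 ^+ 32 * wdisc P Q :> rat.
  rewrite /wdisc -/F discF.
  transitivity (D%:~R * M%:~R ^+ 2 : rat); first by ring.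
  clear -DE ME.
  rewrite DE ME.
  by field.
exact: absz_scaled XE discE.
Qed.
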